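(* Let $G$ be a graph with no isolated vertex that is not a disjoint union of copies of $K_2$, and let $H$ be any nontrivial graph with root $v\in V(H)$. Then $\gamma_R(G\circ_v H)=n(G)\gamma_R(H)$ if and only if $\gamma_R(H-v)\geq\gamma_R(H)$.
   Context: All graphs are finite and simple; a graph is nontrivial if it has at least two vertices; $n(G)=|V(G)|$; $K_2$ is the graph with one edge. For a graph $G$ and a nontrivial graph $H$ with a root $v\in V(H)$, the rooted product graph $G\circ_v H$ is obtained by taking one copy of $G$ and $n(G)$ copies of $H$, and identifying the $i$-th vertex of $G$ with the vertex $v$ in the $i$-th copy of $H$, for each $i$. $H-v$ is $H$ with $v$ deleted. A Roman dominating function on a graph $X$ is $f:V(X)\to\{0,1,2\}$ such that every vertex with value $0$ has a neighbor with value $2$; its weight is $\sum_u f(u)$, and $\gamma_R(X)$ is the minimum weight of such $f$. *)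

(* Defs.v *)
From mathcomp Require Import all_boot.

Set Implicit Arguments.
Unset Strict Implicit.
Unset Printing Implicit Defensive.

Record sgraph := SGraph {
  vertex :> finType;
  adj : rel vertex;
  adj_sym : symmetric adj;
  adj_irr : irreflexive adj
}.

Definition isomorphic (G1 G2 : sgraph) : Prop :=
  exists2 phi : G1 -> G2,
    bijective phi & forall x y, adj (phi x) (phi y) = adj x y.

Definition no_isolated_vertex (G : sgraph) : Prop :=
  forall x : G, exists y : G, adj x y.

Definition nontrivial (G : sgraph) : Prop := 2 <= #|G|.

Section CopiesOfK2.
Variable k : nat.

Definition copies_K2_adj : rel ('I_k * bool) :=
  fun x y => (x.1 == y.1) && (x.2 != y.2).

Lemma copies_K2_sym : symmetric copies_K2_adj.
Proof.
by move=> x y; rewrite /copies_K2_adj eq_sym; congr andb; rewrite eq_sym.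
Qed.

Lemma copies_K2_irr : irreflexive copies_K2_adj.
Proof. by move=> x; rewrite /copies_K2_adj !eqxx. Qed.

(* The disjoint union of k copies of K_2: ordinals index the copies, booleans
   name the two ends of each edge. *)
Definition copies_K2 : sgraph := SGraph copies_K2_sym copies_K2_irr.

End CopiesOfK2.

(* k = 0 is allowed: the graph without vertices is the union of no copies. *)
Definition disjoint_union_of_K2 (G : sgraph) : Prop :=
  exists k : nat, isomorphic G (copies_K2 k).

Section DeleteVertex.
Variables (H : sgraph) (v : H).

Definition del_adj : rel {u : H | u != v} := fun x y => adj (val x) (val y).

Lemma del_sym : symmetric del_adj.
Proof. by move=> x y; apply: adj_sym. Qed.

Lemma del_irr : irreflexive del_adj.
Proof. by move=> x; apply: adj_irr. Qed.

Definition del_vertex : sgraph := SGraph del_sym del_irr.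

End DeleteVertex.

Section RootedProduct.
Variables (G H : sgraph) (v : H).

(* (x, u) is the vertex u of the copy of H attached at x; in particular (x, v)
   is the vertex x of G, identified with the root of that copy. *)
Definition rooted_adj : rel (G * H) := fun p q =>
  ((p.1 == q.1) && adj p.2 q.2) || [&& p.2 == v, q.2 == v & adj p.1 q.1].

Lemma rooted_sym : symmetric rooted_adj.
Proof.
move=> p q; rewrite /rooted_adj (eq_sym p.1) (adj_sym p.2) (adj_sym p.1).
by congr orb; rewrite andbCA.
Qed.

Lemma rooted_irr : irreflexive rooted_adj.
Proof. by move=> p; rewrite /rooted_adj !adj_irr !andbF. Qed.

Definition rooted_product : sgraph := SGraph rooted_sym rooted_irr.

End RootedProduct.

Section RomanDomination.
Variable X : sgraph.
Implicit Type f : {ffun X -> 'I_3}.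

Definition roman_dominating f : bool :=
  [forall u, (f u == 0 :> nat) ==> [exists w, adj u w && (f w == 2 :> nat)]].

Definition weight f : nat := \sum_(u : X) f u.

Definition const2 : {ffun X -> 'I_3} := [ffun=> ord_max].

Lemma roman_dominating_const2 : roman_dominating const2.
Proof. by apply/forallP => u; rewrite ffunE. Qed.

(* arg min only requires some admissible function to start from; const2 is
   one, by roman_dominating_const2. *)
Definition gammaR : nat :=
  weight [arg min_(f < const2 | roman_dominating f) weight f].

Lemma gammaR_min f : roman_dominating f -> gammaR <= weight f.
Proof.
rewrite /gammaR; case: arg_minnP => [|g _]; last exact.
exact: roman_dominating_const2.
Qed.

Lemma gammaR_attained : exists2 f, roman_dominating f & weight f = gammaR.
Proof.
rewrite /gammaR; case: arg_minnP => [|g rg _]; last by exists g.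
exact: roman_dominating_const2.
Qed.

End RomanDomination.

(* Main.v *)
(* Write h = gammaR H and d = gammaR (H - v). On each copy of H a Roman
   dominating function of the product either is Roman dominating for H, or has
   value 0 at the root and is Roman dominating for H - v; so if d >= h every
   copy costs at least h. Otherwise d = h - 1, because h <= d + 1 by giving v
   the value 1. As G is not a union of copies of K_2, some x has two neighbours
   y and z; giving the root value 2 at x and 0 at y and z, and an optimal
   function of H - v on the rest of these three copies, costs
   (h + 1) + 2 (h - 1) = 3 h - 1 there. *)
Require Import Defs.
From mathcomp Require Import all_boot zify.

Set Implicit Arguments.
Unset Strict Implicit.
Unset Printing Implicit Defensive.

(** Symmetry and irreflexivity of [adj] make [m] an involution without fixed points, so its orbits
    are the edges and each orbit becomes one copy of $K_2$. *)
Lemma perfect_matching_disjoint_union_of_K2 (G : sgraph) (m : G -> G) :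
  (forall x y, adj x y = (y == m x)) -> disjoint_union_of_K2 G.
Proof.
move=> adjE.
have mK : involutive m.
  by move=> x; apply/esym/eqP; rewrite -adjE adj_sym adjE.
have m_neq x : m x != x by rewrite eq_sym -adjE adj_irr.
(* [R] picks the end of smaller rank on each edge, so its elements index the copies; equal ranks
   would give a fixed point of [m]. *)
pose R := [set x : G | enum_rank x < enum_rank (m x)].
have Rm x : (m x \in R) = (x \notin R).
  rewrite !inE mK -leqNgt ltn_neqAle; case: eqP => //= /val_inj/enum_rank_inj.
  by move/eqP; rewrite (negPf (m_neq x)).
pose psi (p : 'I_#|R| * bool) : G :=
  if p.2 then m (enum_val p.1) else enum_val p.1.
have m_psi p : m (psi p) = psi (p.1, ~~ p.2).
  by case: p => i []; rewrite /psi /= ?mK.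
have psi_inR p : (psi p \in R) = ~~ p.2.
  by case: p => i []; rewrite /psi /= ?Rm enum_valP.
have psi_inj : injective psi.
  move=> [i b] [j c] eq_psi.
  have eq_bc : b = c by apply: negb_inj; rewrite -(psi_inR (i, b)) eq_psi psi_inR.
  case: c / eq_bc eq_psi => eq_psi; congr (_, _); apply: enum_val_inj.
  by case: b eq_psi => // /(inv_inj mK).
have psi_surj x : exists p, psi p = x.
  have [xR | xR] := boolP (x \in R).
    by exists (enum_rank_in xR x, false); rewrite /psi /= enum_rankK_in.
  rewrite -Rm in xR; exists (enum_rank_in xR (m x), true).
  by rewrite /psi /= enum_rankK_in.
have [phi phiK] := fin_all_exists psi_surj.
exists #|R|; exists phi.
  by exists psi => // p; apply: psi_inj.
move=> x y; rewrite -{2}(phiK x) -{2}(phiK y) adjE m_psi (inj_eq psi_inj).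
case: (phi x) (phi y) => [i b] [j c].
by rewrite /adj /= /copies_K2_adj /= xpair_eqE eq_sym; case: b c => [] [].
Qed.

(** Otherwise any choice [m] of a neighbour for each vertex finds the only one, and the edges form a
    perfect matching. *)
Lemma exists_two_neighbours (G : sgraph) :
    no_isolated_vertex G -> ~ disjoint_union_of_K2 G ->
  exists x y z : G, [/\ adj x y, adj x z & y != z].
Proof.
move=> G_no_isolated G_not_K2s.
case: (boolP [exists x : G, [exists y, [exists z,
          [&& adj x y, adj x z & y != z]]]]).
  by case/existsP=> x /existsP[y /existsP[z /and3P[]]]; exists x, y, z.
move=> no_two; have [m adj_m] := fin_all_exists G_no_isolated.
case: G_not_K2s; apply: (@perfect_matching_disjoint_union_of_K2 G m) => x y.
apply/idP/eqP => [xy | ->//]; apply: contraNeq no_two => y_m.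
apply/existsP; exists x; apply/existsP; exists y; apply/existsP; exists (m x).
by rewrite xy adj_m.
Qed.

Lemma roman_dominatingP (X : sgraph) (f : {ffun X -> 'I_3}) :
  reflect (forall u, f u = 0 :> nat -> exists2 w, adj u w & f w = 2 :> nat)
          (roman_dominating f).
Proof.
apply: (iffP forallP) => [rf u /eqP fu0 | rf u].
  by have /implyP/(_ fu0)/existsP[w /andP[uw /eqP]] := rf u; exists w.
by apply/implyP => /eqP/rf[w uw fw2]; apply/existsP; exists w; rewrite uw fw2.
Qed.

Section DeletedVertex.
Variables (H : sgraph) (v : H).
Implicit Types (f : {ffun H -> 'I_3}) (g : {ffun del_vertex v -> 'I_3}).

Definition restrict f : {ffun del_vertex v -> 'I_3} := [ffun w => f (val w)].

Definition extend (c : 'I_3) g : {ffun H -> 'I_3} :=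
  [ffun u => oapp g c (insub u : option (del_vertex v))].

Lemma extend_root c g : extend c g v = c.
Proof. by rewrite ffunE insubF ?eqxx. Qed.

Lemma extend_val c g w : extend c g (val w) = g w.
Proof. by rewrite ffunE valK. Qed.

Lemma weight_restrict f : weight f = f v + weight (restrict f).
Proof.
rewrite /weight (bigD1 v) //=; congr addn.
rewrite (reindex_omap (val : del_vertex v -> H) insub) /=.
  apply: eq_big => [w | w _]; last by rewrite ffunE.
  by rewrite valK eqxx andbT (valP w).
by move=> u u_v; rewrite insubT.
Qed.

Lemma weight_extend c g : weight (extend c g) = c + weight g.
Proof.
rewrite weight_restrict extend_root; congr (_ + weight _).
by apply/ffunP => w; rewrite ffunE extend_val.
Qed.

(** The root is excluded because its domination depends on [c], so each use has to settle it
    separately. *)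
Lemma extend_dominated c g u : roman_dominating g ->
    u != v -> extend c g u = 0 :> nat ->
  exists2 w, adj u w & extend c g w = 2 :> nat.
Proof.
move=> /roman_dominatingP rg u_v; rewrite -[u](SubK (del_vertex v) u_v).
rewrite extend_val => /rg[w uw gw2]; exists (val w) => //.
by rewrite extend_val.
Qed.

Lemma roman_dominating_restrict f :
    f v = 0 :> nat ->
    (forall u, u != v -> f u = 0 :> nat ->
       exists2 w, adj u w & f w = 2 :> nat) ->
  roman_dominating (restrict f).
Proof.
move=> fv0 rf; apply/roman_dominatingP => u; rewrite ffunE.
move=> /(rf _ (valP u))[w uw fw2].
(* The dominating neighbour survives the deletion, since it has value 2 and the root has value 0. *)
have w_v : w != v by apply: contra_eq_neq fw2 => ->; rewrite fv0.
by exists (Sub w w_v : del_vertex v); rewrite ?ffunE //= /adj /= /del_adj SubK.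
Qed.

Lemma gammaR_le_del_vertexS : gammaR H <= (gammaR (del_vertex v)).+1.
Proof.
have [g rg <-] := gammaR_attained (del_vertex v).
pose f := extend (inord 1) g.
have <- : weight f = (weight g).+1 by rewrite weight_extend inordK.
apply: gammaR_min; apply/roman_dominatingP => u.
have [-> | u_v] := eqVneq u v; first by rewrite extend_root inordK.
exact: extend_dominated.
Qed.

End DeletedVertex.

Section RootedProductDomination.
Variables (G H : sgraph) (v : H).
Implicit Types (F : {ffun rooted_product G v -> 'I_3}).
Implicit Types (k : G -> {ffun H -> 'I_3}).

Definition layer F (x : G) : {ffun H -> 'I_3} := [ffun u => F (x, u)].

Definition glue k : {ffun rooted_product G v -> 'I_3} :=
  [ffun p => k p.1 p.2].

Lemma weight_layers F : weight F = \sum_(x : G) weight (layer F x).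
Proof.
rewrite /weight pair_bigA /=.
by apply: eq_bigr => -[x u] _; rewrite ffunE.
Qed.

Lemma weight_glue k : weight (glue k) = \sum_(x : G) weight (k x).
Proof.
rewrite weight_layers; apply: eq_bigr => x _; congr weight.
by apply/ffunP => u; rewrite !ffunE.
Qed.

(** A vertex may be dominated inside its own copy or, if it is a root, along an edge of [G] by the
    root of another copy. *)
Lemma roman_dominating_glue k :
    (forall x u, k x u = 0 :> nat ->
       (exists2 w, adj u w & k x w = 2 :> nat) \/
       u = v /\ (exists2 y, adj x y & k y v = 2 :> nat)) ->
  roman_dominating (glue k).
Proof.
move=> rk; apply/roman_dominatingP => -[x u]; rewrite ffunE /=.
case/rk=> [[w uw kw2] | [-> [y xy ky2]]].
  by exists (x, w); rewrite ?ffunE // /adj /= /rooted_adj /= eqxx uw.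
by exists (y, v); rewrite ?ffunE // /adj /= /rooted_adj /= !eqxx xy orbT.
Qed.

(** Edges between different copies join roots only, so help from outside can reach only the root. *)
Lemma layer_dominated F x u : roman_dominating F ->
    layer F x u = 0 :> nat ->
  (exists2 w, adj u w & layer F x w = 2 :> nat) \/ u = v.
Proof.
move=> /roman_dominatingP rF; rewrite ffunE => /rF[[y w]].
rewrite /adj /= /rooted_adj /= => /orP[/andP[/eqP <- uw] F2 | /and3P[/eqP]].
  by left; exists w; rewrite ?ffunE.
by right.
Qed.

Lemma gammaR_rooted_product_le : gammaR (rooted_product G v) <= #|G| * gammaR H.
Proof.
have [f /roman_dominatingP rf <-] := gammaR_attained H.
rewrite -sum_nat_const -(weight_glue (fun=> f)).
by apply/gammaR_min/roman_dominating_glue => x u /rf; left.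
Qed.

Lemma weight_layer_ge F x : roman_dominating F ->
    gammaR H <= gammaR (del_vertex v) ->
  gammaR H <= weight (layer F x).
Proof.
move=> rF le_h_d.
have [/gammaR_min // | not_rF] := boolP (roman_dominating (layer F x)).
have dom u : u != v -> layer F x u = 0 :> nat ->
    exists2 w, adj u w & layer F x w = 2 :> nat.
  by move=> /eqP u_v /(layer_dominated rF)[].
(* With a nonzero value at the root, [dom] would cover every vertex of value 0 and the layer would
   be Roman dominating. *)
have Fv0 : layer F x v = 0 :> nat.
  apply: contraNeq not_rF => /eqP Fv; apply/roman_dominatingP => u.
  by have [-> /Fv | /dom] := eqVneq u v.
rewrite (weight_restrict v) Fv0; apply: leq_trans le_h_d _.
exact/gammaR_min/roman_dominating_restrict.
Qed.

Lemma gammaR_rooted_product_ge : gammaR H <= gammaR (del_vertex v) ->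
  #|G| * gammaR H <= gammaR (rooted_product G v).
Proof.
move=> le_h_d; have [F rF <-] := gammaR_attained (rooted_product G v).
rewrite weight_layers -sum_nat_const.
by apply: leq_sum => x _; apply: weight_layer_ge.
Qed.

Lemma gammaR_rooted_product_lt (x y z : G) :
    adj x y -> adj x z -> y != z -> gammaR (del_vertex v) < gammaR H ->
  gammaR (rooted_product G v) < #|G| * gammaR H.
Proof.
move=> xy xz y_z lt_d_h.
have y_x : y != x by apply: contraTneq xy => ->; rewrite adj_irr.
have z_x : z != x by apply: contraTneq xz => ->; rewrite adj_irr.
have [f /roman_dominatingP rf wf] := gammaR_attained H.
have [g rg wg] := gammaR_attained (del_vertex v).
(* The value 2 at the root of copy [x] dominates the roots of copies [y] and [z], which can
   therefore take value 0. *)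
pose k w := if w == x then extend ord_max g
            else if w \in [:: y; z] then extend ord0 g else f.
have /gammaR_min : roman_dominating (glue k).
  apply: roman_dominating_glue => w u.
  have kx : k x v = 2 :> nat by rewrite /k eqxx extend_root.
  have [-> | u_v] := eqVneq u v; rewrite /k.
    case: ifP => _; first by rewrite extend_root.
    case: ifP => [w_yz _ | _ /rf]; last by left.
    right; split=> //; exists x => //; rewrite adj_sym.
    by move: w_yz; rewrite !inE => /orP[] /eqP->.
  by case: ifP => _; [|case: ifP => _]; move=> ku0; left;
    by [apply: extend_dominated | apply: rf].
move/leq_ltn_trans; apply; rewrite weight_glue -sum_nat_const.
(* This isolates the three modified copies; all others cost [gammaR H] on both sides. *)
have split_xyz (a : G -> nat) : \sum_w a w =
    a x + (a y + (a z + \sum_(w | [&& w != x, w != y & w != z]) a w)).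
  rewrite (bigD1 x) //= (bigD1 y) //= (bigD1 z) /=; last first.
    by rewrite z_x eq_sym y_z.
  by under eq_bigl do rewrite -andbA.
rewrite !split_xyz.
rewrite (eq_bigr (fun=> gammaR H)); last first.
  move=> w /and3P[w_x w_y w_z].
  by rewrite /k (negPf w_x) !inE (negPf w_y) (negPf w_z).
rewrite /k eqxx (negPf y_x) (negPf z_x) !inE !eqxx orbT /= !weight_extend wg /=.
(* With $d$ and $h$ the Roman domination numbers of $H-v$ and $H$, it remains that $(d+2)+d+d<3h$,
   which follows from $d+1\leq h$. *)
lia.
Qed.

End RootedProductDomination.

Theorem theorem3p8 (G H : sgraph) (v : H)
    (G_no_isolated : no_isolated_vertex G)
    (G_not_K2s : ~ disjoint_union_of_K2 G)
    (H_nontrivial : nontrivial H) :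
  gammaR (rooted_product G v) = #|G| * gammaR H <->
  gammaR (del_vertex v) >= gammaR H.
Proof.
split=> [eq_nh | le_h_d]; last first.
  by apply/eqP; rewrite eqn_leq gammaR_rooted_product_le gammaR_rooted_product_ge.
rewrite leqNgt; apply/negP => lt_d_h.
have [x [y [z [xy xz y_z]]]] := exists_two_neighbours G_no_isolated G_not_K2s.
by have := gammaR_rooted_product_lt xy xz y_z lt_d_h; rewrite eq_nh ltnn.
Qed.
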